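(* For all $g \geq 1$, let $F_{2g}$ be the free group on $\{x_1,\ldots,x_{2g}\}$ and let $$\pi_1(\Sigma_g) = \left\langle x_1,\ldots,x_{2g} \mid [x_1,x_2]\cdots[x_{2g-1},x_{2g}] = 1\right\rangle.$$ Then there is a short exact sequence $$0 \longrightarrow \mathbb{Z}[\mathbb{Z}^{2g}] \longrightarrow [F_{2g},F_{2g}]^{\mathrm{ab}} \longrightarrow [\pi_1(\Sigma_g),\pi_1(\Sigma_g)]^{\mathrm{ab}} \longrightarrow 0$$ of $\mathbb{Z}[\mathbb{Z}^{2g}]$-modules.
   Context: $\Sigma_g$ is a closed oriented surface of genus $g$. For elements $x,y$ of a group, $[x,y] = x^{-1}y^{-1}xy$. For a group $G$, $G^{\mathrm{ab}}$ denotes its abelianization. For $G = F_{2g}$ or $G = \pi_1(\Sigma_g)$, the conjugation action of $G$ on $[G,G]$ induces an action of $G$ on $[G,G]^{\mathrm{ab}}$ that factors through $G/[G,G] \cong \mathbb{Z}^{2g}$ (with basis the images of $x_1,\ldots,x_{2g}$), making $[G,G]^{\mathrm{ab}}$ into a $\mathbb{Z}[\mathbb{Z}^{2g}]$-module. *)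

(* Defs.v *)
(* MathComp quotient types need boolean equivalence relations; boolp is used to
   turn the (undecidable) relations below into boolean ones. *)
From HB Require Import structures.
From mathcomp Require Import all_boot all_order all_algebra generic_quotient.
From mathcomp Require Import finmap.
From mathcomp Require Import boolp.
From mathcomp Require Import xfinmap monalg.

Set Implicit Arguments.
Unset Strict Implicit.
Unset Printing Implicit Defensive.

Import GRing.Theory.
Local Open Scope quotient_scope.
Local Open Scope ring_scope.

Section Subgroups.
Variable G : groupType.
Local Open Scope group_scope.
Implicit Types (S : G -> Prop) (x y z : G).

Record normal_subgroup := NormalSubgroup {
  nsg_mem :> G -> Prop;
  nsg1 : nsg_mem 1;
  nsgM : forall x y, nsg_mem x -> nsg_mem y -> nsg_mem (x * y);
  nsgV : forall x, nsg_mem x -> nsg_mem x^-1;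
  nsgJ : forall x y, nsg_mem x -> nsg_mem (x ^ y) }.

Inductive generated S : G -> Prop :=
| gen_mem x of S x : generated S x
| gen1 : generated S 1
| genM x y of generated S x & generated S y : generated S (x * y)
| genV x of generated S x : generated S x^-1.

Lemma gen_sub S (T : G -> Prop) :
    (forall x, S x -> T x) -> T 1 ->
    (forall x y, T x -> T y -> T (x * y)) -> (forall x, T x -> T x^-1) ->
  forall x, generated S x -> T x.
Proof. by move=> ST T1 TM TV x; elim=> *; auto. Qed.

Lemma genJ S : (forall x y, S x -> S (x ^ y)) ->
  forall x y, generated S x -> generated S (x ^ y).
Proof.
move=> SJ x y; elim=> [{}x Sx||{}x z _ ? _ ?|{}x _ ?].
- by apply: gen_mem; apply: SJ.
- by rewrite conj1g; apply: gen1.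
- by rewrite conjMg; apply: genM.
- by rewrite conjVg; apply: genV.
Qed.

Definition conjugates S x := exists y z, S y /\ x = y ^ z.

Fact conjugatesJ S x y : conjugates S x -> conjugates S (x ^ y).
Proof. by move=> [u [z [Su ->]]]; exists u, (z * y); rewrite conjgM. Qed.

Definition normal_closure S : normal_subgroup :=
  @NormalSubgroup (generated (conjugates S)) (gen1 _) (@genM _) (@genV _)
                  (genJ (@conjugatesJ S)).

Definition is_commutator x := exists y z, x = [~ y, z].

Fact is_commutatorJ x y : is_commutator x -> is_commutator (x ^ y).
Proof.
by move=> [u [v ->]]; exists (u ^ y), (v ^ y); rewrite conjRg.
Qed.

Definition commutator_subgroup : normal_subgroup :=
  @NormalSubgroup (generated is_commutator) (gen1 _) (@genM _) (@genV _)
                  (genJ is_commutatorJ).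

End Subgroups.

Section QuotientGroup.
Variables (G : groupType) (N : normal_subgroup G).
Local Open Scope group_scope.

Definition coset_rel : rel G := fun x y => `[< N (x^-1 * y) >].

Fact coset_rel_refl : reflexive coset_rel.
Proof. by move=> x; apply/asboolP; rewrite mulVg; apply: nsg1. Qed.

Fact coset_rel_sym : symmetric coset_rel.
Proof.
by move=> x y; apply/asboolP/asboolP => /nsgV; rewrite invgM invgK.
Qed.

Fact coset_rel_trans : transitive coset_rel.
Proof.
move=> y x z /asboolP Nxy /asboolP Nyz; apply/asboolP.
by have := nsgM Nxy Nyz; rewrite mulgA mulgK.
Qed.

Canonical coset_equiv :=
  EquivRel coset_rel coset_rel_refl coset_rel_sym coset_rel_trans.

Definition quotient_group := {eq_quot coset_equiv}.

HB.instance Definition _ := Choice.on quotient_group.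
HB.instance Definition _ := EqQuotient.on quotient_group.

Definition coset (x : G) : quotient_group := \pi x.

Lemma coset_eqP x y : coset x = coset y <-> N (x^-1 * y).
Proof. by split=> [/eqmodP/asboolP|Nxy]; last exact/eqmodP/asboolP. Qed.

Lemma cosetP (u : quotient_group) : coset (repr u) = u.
Proof. exact: reprK. Qed.

Definition quotient_mul (u v : quotient_group) := coset (repr u * repr v).
Definition quotient_inv (u : quotient_group) := coset (repr u)^-1.

Lemma quotient_mulE x y : quotient_mul (coset x) (coset y) = coset (x * y).
Proof.
have /coset_eqP Nx := cosetP (coset x); have /coset_eqP Ny := cosetP (coset y).
apply/coset_eqP; set a := repr _ in Nx *; set b := repr _ in Ny *.
have := nsgM (nsgJ b Nx) Ny; rewrite conjgE invgM.
by rewrite !mulgA mulgK.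
Qed.

Lemma quotient_invE x : quotient_inv (coset x) = coset x^-1.
Proof.
have /coset_eqP/(nsgJ (repr (coset x))^-1)/nsgV := cosetP (coset x).
move=> Nx; apply/coset_eqP.
by move: Nx; rewrite invgK conjgE invgK -mulgA mulVKg invgM invgK.
Qed.

Fact quotient_mulA : associative quotient_mul.
Proof.
move=> u v w; rewrite -(cosetP u) -(cosetP v) -(cosetP w).
by rewrite !quotient_mulE mulgA.
Qed.
Fact quotient_mul1 : left_id (coset 1) quotient_mul.
Proof. by move=> u; rewrite -(cosetP u) quotient_mulE mul1g. Qed.
Fact quotient_mulr1 : right_id (coset 1) quotient_mul.
Proof. by move=> u; rewrite -(cosetP u) quotient_mulE mulg1. Qed.
Fact quotient_mulV : left_inverse (coset 1) quotient_inv quotient_mul.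
Proof.
by move=> u; rewrite -(cosetP u) quotient_invE quotient_mulE mulVg.
Qed.
Fact quotient_mulrV : right_inverse (coset 1) quotient_inv quotient_mul.
Proof.
by move=> u; rewrite -(cosetP u) quotient_invE quotient_mulE mulgV.
Qed.

HB.instance Definition _ := isGroup.Build quotient_group
  quotient_mulA quotient_mul1 quotient_mulr1 quotient_mulV quotient_mulrV.

Lemma cosetM x y : coset (x * y) = coset x * coset y.
Proof. by rewrite -quotient_mulE. Qed.
Lemma coset1 : coset 1 = 1. Proof. by []. Qed.
Lemma cosetV x : coset x^-1 = (coset x)^-1.
Proof. by rewrite -quotient_invE. Qed.

End QuotientGroup.

Section FreeGroup.
Variable n : nat.

(* The letter (i, false) stands for the i-th generator, (i, true) for its
   inverse. *)
Definition letter := ('I_n * bool)%type.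
Definition word := seq letter.

Definition inv_letter (l : letter) : letter := (l.1, ~~ l.2).
Definition inv_word (w : word) : word := rev (map inv_letter w).

Inductive word_equiv : word -> word -> Prop :=
| word_equiv_refl w : word_equiv w w
| word_equiv_sym v w of word_equiv v w : word_equiv w v
| word_equiv_trans u v w of word_equiv u v & word_equiv v w : word_equiv u w
| word_equiv_cancel u l v : word_equiv (u ++ l :: inv_letter l :: v) (u ++ v).

Lemma inv_letterK : involutive inv_letter.
Proof. by case=> i b; rewrite /inv_letter /= negbK. Qed.

Lemma word_equiv_catl u v w : word_equiv v w -> word_equiv (u ++ v) (u ++ w).
Proof.
elim=> [x|x y _|x y z _ xy _|x l y].
- exact: word_equiv_refl.
- exact: word_equiv_sym.
- exact: word_equiv_trans.
- by rewrite !catA; apply: word_equiv_cancel.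
Qed.

Lemma word_equiv_catr u v w : word_equiv v w -> word_equiv (v ++ u) (w ++ u).
Proof.
elim=> [x|x y _|x y z _ xy _|x l y].
- exact: word_equiv_refl.
- exact: word_equiv_sym.
- exact: word_equiv_trans.
- by rewrite -!catA /=; apply: word_equiv_cancel.
Qed.

Lemma word_equiv_inv v w : word_equiv v w -> word_equiv (inv_word v) (inv_word w).
Proof.
elim=> [x|x y _|x y z _ xy _|x l y].
- exact: word_equiv_refl.
- exact: word_equiv_sym.
- exact: word_equiv_trans.
rewrite /inv_word !map_cat /= !rev_cat !rev_cons -!cats1 -!catA /=.
rewrite inv_letterK; exact: word_equiv_cancel.
Qed.

Lemma word_equivV w : word_equiv (inv_word w ++ w) [::].
Proof.
elim: w => [|l w IHw]; first exact: word_equiv_refl.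
rewrite /inv_word /= rev_cons -cats1 -catA /= -{2}(inv_letterK l).
exact: word_equiv_trans (word_equiv_cancel _ _ _) IHw.
Qed.

Lemma inv_wordK : involutive inv_word.
Proof.
move=> w; rewrite /inv_word map_rev revK -map_comp.
by rewrite (eq_map (g := id)) ?map_id //; apply: inv_letterK.
Qed.

Definition word_rel : rel word := fun v w => `[< word_equiv v w >].

Fact word_rel_refl : reflexive word_rel.
Proof. by move=> w; apply/asboolP/word_equiv_refl. Qed.
Fact word_rel_sym : symmetric word_rel.
Proof. by move=> v w; apply/asboolP/asboolP => /word_equiv_sym. Qed.
Fact word_rel_trans : transitive word_rel.
Proof.
move=> v u w /asboolP uv /asboolP vw; apply/asboolP.
exact: word_equiv_trans vw.
Qed.

Canonical word_equiv_rel :=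
  EquivRel word_rel word_rel_refl word_rel_sym word_rel_trans.

Definition free_group := {eq_quot word_equiv_rel}.

HB.instance Definition _ := Choice.on free_group.
HB.instance Definition _ := EqQuotient.on free_group.

Definition word_class (w : word) : free_group := \pi w.

Lemma word_class_eqP v w : word_class v = word_class w <-> word_equiv v w.
Proof. by split=> [/eqmodP/asboolP|vw]; last exact/eqmodP/asboolP. Qed.

Lemma word_classP (u : free_group) : word_class (repr u) = u.
Proof. exact: reprK. Qed.

Definition free_mul (u v : free_group) := word_class (repr u ++ repr v).
Definition free_inv (u : free_group) := word_class (inv_word (repr u)).

Lemma free_mulE v w :
  free_mul (word_class v) (word_class w) = word_class (v ++ w).
Proof.
have /word_class_eqP Ev := word_classP (word_class v).
have /word_class_eqP Ew := word_classP (word_class w).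
apply/word_class_eqP; apply: word_equiv_trans (word_equiv_catr _ Ev) _.
exact: word_equiv_catl.
Qed.

Lemma free_invE w : free_inv (word_class w) = word_class (inv_word w).
Proof.
by apply/word_class_eqP/word_equiv_inv/word_class_eqP; rewrite word_classP.
Qed.

Fact free_mulA : associative free_mul.
Proof.
move=> u v w; rewrite -(word_classP u) -(word_classP v) -(word_classP w).
by rewrite !free_mulE catA.
Qed.
Fact free_mul1 : left_id (word_class [::]) free_mul.
Proof. by move=> u; rewrite -(word_classP u) free_mulE. Qed.
Fact free_mulr1 : right_id (word_class [::]) free_mul.
Proof. by move=> u; rewrite -(word_classP u) free_mulE cats0. Qed.
Fact free_mulV : left_inverse (word_class [::]) free_inv free_mul.
Proof.
move=> u; rewrite -(word_classP u) free_invE free_mulE.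
exact/word_class_eqP/word_equivV.
Qed.
Fact free_mulrV : right_inverse (word_class [::]) free_inv free_mul.
Proof.
move=> u; rewrite -(word_classP u) free_invE free_mulE.
apply/word_class_eqP; rewrite -{1}(inv_wordK (repr u)); exact: word_equivV.
Qed.

HB.instance Definition _ := isGroup.Build free_group
  free_mulA free_mul1 free_mulr1 free_mulV free_mulrV.

Definition free_gen (i : 'I_n) : free_group := word_class [:: (i, false)].

Lemma word_class_cat v w :
  word_class (v ++ w) = (word_class v * word_class w)%g.
Proof. by rewrite -free_mulE. Qed.

Lemma word_class_letter i b :
  word_class [:: (i, b)] = (if b then (free_gen i)^-1 else free_gen i)%g.
Proof. by case: b => //; apply: esym (free_invE [:: (i, false)]). Qed.

Lemma free_group_ind (P : free_group -> Prop) :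
    P 1%g -> (forall i, P (free_gen i)) ->
    (forall u v, P u -> P v -> P (u * v)%g) -> (forall u, P u -> P u^-1%g) ->
  forall u, P u.
Proof.
move=> P1 Pg PM PV u; rewrite -(word_classP u).
elim: (repr u) => [//|[i b] w Pw].
rewrite -cat1s word_class_cat; apply: PM => //.
by rewrite word_class_letter; case: b; [apply: PV|]; apply: Pg.
Qed.

End FreeGroup.

Definition presented_group n (R : free_group n -> Prop) :=
  quotient_group (normal_closure R).

HB.instance Definition _ n R := Group.on (@presented_group n R).

Definition presented_gen n (R : free_group n -> Prop) (i : 'I_n) :
  presented_group R := coset _ (free_gen i).

Section SurfaceGroup.
Variable g : nat.

Fact surface_index0_subproof (i : 'I_g) : (2 * i < 2 * g)%N.
Proof. by rewrite ltn_pmul2l. Qed.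
Fact surface_index1_subproof (i : 'I_g) : ((2 * i).+1 < 2 * g)%N.
Proof. by have := ltn_ord i; rewrite -(@leq_pmul2l 2) // mulnS. Qed.

(* Generators are numbered from 0, so the i-th handle is given by the
   generators numbered 2i and 2i+1. *)
Definition surface_index0 i : 'I_(2 * g) := Ordinal (surface_index0_subproof i).
Definition surface_index1 i : 'I_(2 * g) := Ordinal (surface_index1_subproof i).

Definition surface_relator : free_group (2 * g) :=
  (\prod_(i < g)
     [~ free_gen (surface_index0 i), free_gen (surface_index1 i)])%g.

Definition surface_group := presented_group (fun r => r = surface_relator).

HB.instance Definition _ := Group.on surface_group.

Definition surface_gen (i : 'I_(2 * g)) : surface_group := presented_gen _ i.

End SurfaceGroup.

Section Abelianization.
Variable G : groupType.

Definition abelianization := quotient_group (commutator_subgroup G).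

HB.instance Definition _ := Choice.on abelianization.

Definition ab_class (x : G) : abelianization := coset _ x.

Lemma ab_class_eqP x y :
  ab_class x = ab_class y <-> commutator_subgroup G (x^-1 * y)%g.
Proof. exact: coset_eqP. Qed.

Lemma ab_classP (u : abelianization) : ab_class (repr u) = u.
Proof. exact: cosetP. Qed.

Definition ab_add (u v : abelianization) : abelianization := (u * v)%g.
Definition ab_opp (u : abelianization) : abelianization := (u^-1)%g.

Fact ab_addA : associative ab_add. Proof. exact: mulgA. Qed.
Fact ab_addC : commutative ab_add.
Proof.
move=> u v; rewrite -(ab_classP u) -(ab_classP v) /ab_add -!cosetM.
apply/coset_eqP; apply: gen_mem; exists (repr v), (repr u).
by rewrite /commg conjgE invgM !mulgA.
Qed.
Fact ab_add0 : left_id (ab_class 1) ab_add. Proof. exact: mul1g. Qed.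
Fact ab_addN : left_inverse (ab_class 1) ab_opp ab_add.
Proof. exact: mulVg. Qed.

HB.instance Definition _ := GRing.isZmodule.Build abelianization
  ab_addA ab_addC ab_add0 ab_addN.

Lemma ab_classM x y : ab_class (x * y)%g = ab_class x + ab_class y.
Proof. exact: cosetM. Qed.
Lemma ab_class1 : ab_class 1%g = 0. Proof. by []. Qed.
Lemma ab_classV x : ab_class (x^-1)%g = - ab_class x.
Proof. exact: cosetV. Qed.

End Abelianization.

Section CommutatorGroup.
Variable G : groupType.
Local Open Scope group_scope.

Definition in_commutator_subgroup : pred G :=
  fun x => `[< commutator_subgroup G x >].

Fact in_commutator_subgroup_closed : group_closed in_commutator_subgroup.
Proof.
split; first exact/asboolP/nsg1.
move=> x y /asboolP Gx /asboolP Gy; apply/asboolP.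
by apply: nsgM => //; apply: nsgV.
Qed.

Record commutator_group := CommutatorGroup {
  comm_val :> G;
  comm_valP : in_commutator_subgroup comm_val }.

HB.instance Definition _ := [isSub for comm_val].
HB.instance Definition _ := [Choice of commutator_group by <:].
HB.instance Definition _ := SubChoice_isSubGroup.Build
  G in_commutator_subgroup commutator_group in_commutator_subgroup_closed.

Fact conj_comm_subproof (x : G) (c : commutator_group) :
  in_commutator_subgroup (x * comm_val c * x^-1).
Proof.
apply/asboolP; have /asboolP := comm_valP c => /(nsgJ x^-1).
by rewrite conjgE invgK mulgA.
Qed.

Definition conj_comm (x : G) (c : commutator_group) : commutator_group :=
  CommutatorGroup (conj_comm_subproof x c).

Lemma conj_commM x c d : conj_comm x (c * d) = conj_comm x c * conj_comm x d.
Proof. by apply: val_inj; rewrite /= !mulgA mulgVK. Qed.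
Lemma conj_commV x c : conj_comm x c^-1 = (conj_comm x c)^-1.
Proof. by apply: val_inj; rewrite /= !invgM invgK !mulgA. Qed.
Lemma conj_comm_mul x y c : conj_comm (x * y) c = conj_comm x (conj_comm y c).
Proof. by apply: val_inj; rewrite /= invgM !mulgA. Qed.
Lemma conj_comm1 c : conj_comm 1 c = c.
Proof. by apply: val_inj; rewrite /= invg1 mulg1 mul1g. Qed.

Lemma conj_comm_sub x c d : commutator_subgroup commutator_group (c^-1 * d) ->
  commutator_subgroup commutator_group ((conj_comm x c)^-1 * conj_comm x d).
Proof.
rewrite -conj_commV -conj_commM; move: (c^-1 * d) => {c d}.
apply: gen_sub => [_ [c [d ->]]||c d|c].
- apply: gen_mem; exists (conj_comm x c), (conj_comm x d).
  by rewrite /commg /conjg !(conj_commM, conj_commV).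
- suff -> : conj_comm x 1 = 1 by apply: gen1.
  by apply: val_inj; rewrite /= mulg1 mulgV.
- by rewrite conj_commM; apply: genM.
- by rewrite conj_commV; apply: genV.
Qed.

End CommutatorGroup.

Section ConjugationAction.
Variable G : groupType.
Local Notation V := (abelianization (commutator_group G)).

Definition conj_ab (x : G) (v : V) : V := ab_class (conj_comm x (repr v)).

Lemma conj_abE x c : conj_ab x (ab_class c) = ab_class (conj_comm x c).
Proof.
apply/ab_class_eqP; apply: conj_comm_sub.
by apply/ab_class_eqP; rewrite ab_classP.
Qed.

Lemma conj_abM x y v : conj_ab (x * y)%g v = conj_ab x (conj_ab y v).
Proof. by rewrite -(ab_classP v) !conj_abE conj_comm_mul. Qed.

Lemma conj_ab1 v : conj_ab 1%g v = v.
Proof. by rewrite -(ab_classP v) conj_abE conj_comm1. Qed.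

Lemma conj_abD x u v : conj_ab x (u + v) = conj_ab x u + conj_ab x v.
Proof.
rewrite -(ab_classP u) -(ab_classP v) -ab_classM !conj_abE conj_commM.
exact: ab_classM.
Qed.

Lemma conj_ab_comm x v : commutator_subgroup G x -> conj_ab x v = v.
Proof.
move=> /asboolP Gx; rewrite -(ab_classP v) conj_abE.
pose d := CommutatorGroup Gx.
have -> : conj_comm x (repr v) = (d * repr v * d^-1)%g by apply: val_inj.
by rewrite !ab_classM ab_classV addrC addKr.
Qed.

Definition ab_act (q : abelianization G) (v : V) : V := conj_ab (repr q) v.

Lemma ab_actE x v : ab_act (ab_class x) v = conj_ab x v.
Proof.
rewrite /ab_act; set y := repr _.
have /ab_class_eqP Gyx : ab_class y = ab_class x by rewrite ab_classP.
by rewrite -[x in RHS](mulVKg y) conj_abM (conj_ab_comm _ Gyx).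
Qed.

Lemma ab_act_add p q v : ab_act (p + q) v = ab_act p (ab_act q v).
Proof.
by rewrite -(ab_classP p) -(ab_classP q) -ab_classM !ab_actE conj_abM.
Qed.

Lemma ab_act0 v : ab_act 0 v = v.
Proof. by rewrite -ab_class1 ab_actE conj_ab1. Qed.

Lemma ab_actD q u v : ab_act q (u + v) = ab_act q u + ab_act q v.
Proof. exact: conj_abD. Qed.

End ConjugationAction.

(* The library makes {malg int[K]} a ring only when K is a monoid without
   nontrivial units, which excludes groups. *)
Definition group_ring (A : zmodType) := {malg int[A]}.

HB.instance Definition _ (A : zmodType) := GRing.Zmodule.on (group_ring A).

Section GroupRing.
Variable A : zmodType.
Implicit Types (u v w : group_ring A) (a b : A).

Definition gr_elt a : group_ring A := << (1 : int) *g a >>.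

Section Extend.
Variables (V : zmodType) (phi : A -> V).

Definition gr_extend u : V := \sum_(a <- msupp u) phi a *~ mcoeff a u.

Lemma gr_extendw (d : {fset A}) u : (msupp u `<=` d)%fset ->
  gr_extend u = \sum_(a <- d) phi a *~ mcoeff a u.
Proof.
move=> le_d; rewrite /gr_extend; apply: big_fset_incl => // a _.
by move=> /mcoeff_outdom ->; rewrite mulr0z.
Qed.

Lemma gr_extendD u v : gr_extend (u + v) = gr_extend u + gr_extend v.
Proof.
rewrite (gr_extendw (msuppD_le u v)) (gr_extendw (fsubsetUl _ (msupp v))).
rewrite (gr_extendw (fsubsetUr (msupp u) _)) -big_split /=.
by apply: eq_bigr => a _; rewrite mcoeffD mulrzDr.
Qed.

Lemma gr_extend_elt a : gr_extend (gr_elt a) = phi a.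
Proof.
by rewrite (gr_extendw (msuppU_le (k := a))) big_seq_fset1 mcoeffUU.
Qed.

Lemma gr_extend0 : gr_extend 0 = 0.
Proof. by rewrite /gr_extend msupp0 big_seq_fset0. Qed.

End Extend.

Lemma gr_ind (P : group_ring A -> Prop) : P 0 ->
    (forall u v, P u -> P v -> P (u + v)) -> (forall u, P u -> P (- u)) ->
    (forall a, P (gr_elt a)) ->
  forall u, P u.
Proof.
move=> P0 PD PN Pe u; rewrite (monalgE u).
elim/big_ind: _ => // a _.
have Pn n : P (<< n%:Z *g a >>).
  elim: n => [|n IHn]; first by rewrite monalgU0.
  by rewrite intS monalgUD; apply: PD => //; exact: Pe.
case: (mcoeff a u) => n; first exact: Pn.
by rewrite NegzE monalgUN; apply/PN/Pn.
Qed.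

Lemma gr_additive_eq (V : zmodType) (f h : group_ring A -> V) :
    {morph f : u v / u + v} -> {morph h : u v / u + v} ->
    (forall a, f (gr_elt a) = h (gr_elt a)) ->
  f =1 h.
Proof.
move=> fD hD fh.
have f0 : f 0 = 0 by apply: (addIr (f 0)); rewrite -fD !add0r.
have h0 : h 0 = 0 by apply: (addIr (h 0)); rewrite -hD !add0r.
elim/gr_ind => [|u v IHu IHv|u IHu|a]; rewrite ?f0 ?h0 ?fD ?hD ?IHu ?IHv //.
by apply: (addIr (f u)); rewrite -fD IHu -hD !addNr f0 h0.
Qed.

Lemma gr_extend_add (V : zmodType) (phi psi : A -> V) u :
  gr_extend (fun a => phi a + psi a) u = gr_extend phi u + gr_extend psi u.
Proof. by rewrite -big_split /=; apply: eq_bigr => a _; rewrite mulrzDl. Qed.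

Definition gr_mul u v : group_ring A :=
  gr_extend (fun a => gr_extend (fun b => gr_elt (a + b)) v) u.

Lemma gr_mul_elt a b : gr_mul (gr_elt a) (gr_elt b) = gr_elt (a + b).
Proof. by rewrite /gr_mul !gr_extend_elt. Qed.

Fact gr_mulDl : left_distributive gr_mul +%R.
Proof. by move=> u v w; apply: gr_extendD. Qed.

Fact gr_mulDr : right_distributive gr_mul +%R.
Proof.
move=> u v w; rewrite /gr_mul -gr_extend_add.
by apply: eq_bigr => a _; rewrite gr_extendD.
Qed.

Fact gr_mulC : commutative gr_mul.
Proof.
move=> u v; move: u; apply: gr_additive_eq => [u w|u w|a].
- exact: gr_mulDl.
- exact: gr_mulDr.
move: v; apply: gr_additive_eq => [u w|u w|b].
- exact: gr_mulDr.
- exact: gr_mulDl.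
by rewrite !gr_mul_elt addrC.
Qed.

Fact gr_mulA : associative gr_mul.
Proof.
move=> u v w; move: u; apply: gr_additive_eq => [u u'|u u'|a].
- exact: gr_mulDl.
- by rewrite !gr_mulDl.
move: v; apply: gr_additive_eq => [u u'|u u'|b].
- by rewrite gr_mulDl gr_mulDr.
- by rewrite gr_mulDr gr_mulDl.
move: w; apply: gr_additive_eq => [u u'|u u'|c].
- by rewrite !gr_mulDr.
- exact: gr_mulDr.
by rewrite !gr_mul_elt addrA.
Qed.

Fact gr_mul1 : left_id (gr_elt 0) gr_mul.
Proof.
apply: gr_additive_eq => [u u'|//|a]; first exact: gr_mulDr.
by rewrite gr_mul_elt add0r.
Qed.

Fact gr_one_neq0 : gr_elt 0 != 0. Proof. by rewrite monalgU_eq0. Qed.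

HB.instance Definition _ := GRing.Zmodule_isComNzRing.Build (group_ring A)
  gr_mulA gr_mulC gr_mul1 gr_mulDl gr_one_neq0.

End GroupRing.

(* The family x is a parameter of the type because it determines the module
   structure: a : 'rV[int]_n acts as the element ab_comb x a of G^ab, where
   ab_comb x is the homomorphism Z^n -> G^ab sending the i-th basis vector to
   the class of x i. It is an isomorphism in the cases of interest, see
   free_ab_comb_bij and surface_ab_comb_bij. *)
Definition commutator_module n (G : groupType) (x : 'I_n -> G) :=
  abelianization (commutator_group G).

HB.instance Definition _ n G x :=
  GRing.Zmodule.on (@commutator_module n G x).

Section CommutatorModule.
Variables (n : nat) (G : groupType) (x : 'I_n -> G).

Definition ab_comb (a : 'rV[int]_n) : abelianization G :=
  \sum_i ab_class (x i) *~ a 0 i.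

Lemma ab_combD a b : ab_comb (a + b) = ab_comb a + ab_comb b.
Proof.
by rewrite -big_split /=; apply: eq_bigr => i _; rewrite mxE mulrzDr.
Qed.

Lemma ab_comb0 : ab_comb 0 = 0.
Proof. by apply: (addIr (ab_comb 0)); rewrite -ab_combD !add0r. Qed.

Lemma ab_comb_delta i : ab_comb (delta_mx 0 i) = ab_class (x i).
Proof.
rewrite /ab_comb (bigD1 i) //= big1 => [|j /negbTE ji].
  by rewrite mxE !eqxx addr0.
by rewrite mxE ji andbF.
Qed.

Local Notation commutator_module := (commutator_module x).

Implicit Types (r s : group_ring 'rV[int]_n) (v : commutator_module).

Definition cm_scale r v : commutator_module :=
  gr_extend (fun a => ab_act (ab_comb a) v) r.

Fact cm_scaleDl v : {morph cm_scale^~ v : r s / r + s}.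
Proof. by move=> r s; apply: gr_extendD. Qed.

Fact cm_scaleDr : right_distributive cm_scale +%R.
Proof.
move=> r u v; rewrite /cm_scale -gr_extend_add; congr gr_extend.
by apply: funext => a; apply: ab_actD.
Qed.

Lemma cm_scale_elt a v : cm_scale (gr_elt a) v = ab_act (ab_comb a) v.
Proof. exact: gr_extend_elt. Qed.

Fact cm_scaleA r s v : cm_scale r (cm_scale s v) = cm_scale (r * s) v.
Proof.
move: r; apply: gr_additive_eq => [r r'|r r'|a]; rewrite ?mulrDl ?cm_scaleDl //.
move: s; apply: gr_additive_eq => [s s'|s s'|b].
- by rewrite cm_scaleDl cm_scaleDr.
- by rewrite mulrDr cm_scaleDl.
have -> : gr_elt a * gr_elt b = gr_elt (a + b) by apply: gr_mul_elt.
by rewrite !cm_scale_elt ab_combD ab_act_add.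
Qed.

Fact cm_scale1 : left_id 1 cm_scale.
Proof. by move=> v; rewrite [LHS]cm_scale_elt ab_comb0 ab_act0. Qed.

HB.instance Definition _ := GRing.Zmodule_isLmodule.Build
  (group_ring 'rV[int]_n) commutator_module
  cm_scaleA cm_scale1 cm_scaleDr cm_scaleDl.

Lemma cm_scale_delta i c :
  gr_elt (delta_mx 0 i) *: (ab_class c : commutator_module)
    = ab_class (conj_comm (x i) c).
Proof.
by rewrite [LHS]cm_scale_elt ab_comb_delta ab_actE conj_abE.
Qed.

End CommutatorModule.

Section ExponentSum.
Variable n : nat.

Definition letter_exp (l : letter n) : 'rV[int]_n :=
  delta_mx 0 l.1 *~ (-1) ^+ l.2.
Definition word_exp (w : word n) := \sum_(l <- w) letter_exp l.

Lemma word_exp_cat v w : word_exp (v ++ w) = word_exp v + word_exp w.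
Proof. exact: big_cat. Qed.

Lemma word_exp_equiv v w : word_equiv v w -> word_exp v = word_exp w.
Proof.
elim=> // [u {}v {}w _ -> _ -> //|u l {}v].
rewrite !word_exp_cat; congr (_ + _); rewrite /word_exp !big_cons addrA.
suff -> : letter_exp l + letter_exp (inv_letter l) = 0 by rewrite add0r.
by rewrite -mulrzDr; case: l => i [].
Qed.

Definition free_exp (u : free_group n) := word_exp (repr u).

Lemma free_expM u v : free_exp (u * v)%g = free_exp u + free_exp v.
Proof.
rewrite -word_exp_cat; apply: word_exp_equiv; apply/word_class_eqP.
by rewrite word_class_cat !word_classP.
Qed.

Lemma free_exp1 : free_exp 1%g = 0.
Proof. by apply: (addIr (free_exp 1%g)); rewrite -free_expM mulg1 add0r. Qed.

Lemma free_expV u : free_exp (u^-1)%g = - free_exp u.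
Proof.
by apply: (addIr (free_exp u)); rewrite -free_expM mulVg free_exp1 addNr.
Qed.

Lemma free_exp_gen i : free_exp (free_gen i) = delta_mx 0 i.
Proof.
have /word_class_eqP/word_exp_equiv := word_classP (free_gen i).
by rewrite /free_exp => ->; rewrite /word_exp big_seq1 /letter_exp.
Qed.

Lemma free_expR u v : free_exp [~ u, v]%g = 0.
Proof.
by rewrite /commg conjgE !free_expM !free_expV addrCA addKr addrC subrr.
Qed.

Variables (G : groupType) (p : free_group n -> G).
Hypothesis pM : {morph p : u v / (u * v)%g}.
Hypothesis p_surj : forall y, exists u, p u = y.
Hypothesis p_ker : forall u, p u = 1%g -> free_exp u = 0.

Let p1 : p 1%g = 1%g.
Proof. by apply: (mulIg (p 1%g)); rewrite -pM !mul1g. Qed.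

Let pV u : p (u^-1)%g = ((p u)^-1)%g.
Proof. by apply: (mulIg (p u)); rewrite -pM !mulVg p1. Qed.

Lemma ab_comb_exp u :
  ab_comb (fun i => p (free_gen i)) (free_exp u) = ab_class (p u).
Proof.
elim/free_group_ind: u => [|i|u v IHu IHv|u IHu].
- by rewrite free_exp1 ab_comb0 p1 ab_class1.
- by rewrite free_exp_gen ab_comb_delta.
- by rewrite free_expM ab_combD pM ab_classM IHu IHv.
- rewrite pV ab_classV free_expV -IHu; set a := free_exp u.
  by apply: (addIr (ab_comb (fun i => p (free_gen i)) a));
     rewrite -ab_combD !addNr ab_comb0.
Qed.

Lemma free_exp_surj a : exists u, free_exp u = a.
Proof.
rewrite (row_sum_delta a); elim/big_ind: _ => [|_ _ [u <-] [v <-]|i _].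
- by exists 1%g; rewrite free_exp1.
- by exists (u * v)%g; rewrite free_expM.
have Pn m : exists u, free_exp u = m%:Z *: delta_mx 0 i.
  elim: m => [|m [u Eu]]; first by exists 1%g; rewrite free_exp1 scale0r.
  by exists (free_gen i * u)%g;
     rewrite free_expM free_exp_gen Eu intS scalerDl scale1r.
case: (a 0 i) => m; first exact: Pn.
by have [u Eu] := Pn m.+1; exists (u^-1)%g; rewrite NegzE scaleNr free_expV Eu.
Qed.

Lemma commutator_exp y : commutator_subgroup G y ->
  exists2 u, p u = y & free_exp u = 0.
Proof.
move: y; apply: gen_sub => [_ [b [c ->]]||_ _ [u <- u0] [v <- v0]|_ [u <- u0]].
- have [u <-] := p_surj b; have [v <-] := p_surj c.
  exists [~ u, v]%g; last exact: free_expR.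
  by rewrite /commg /conjg !(pM, pV).
- by exists 1%g; rewrite ?p1 ?free_exp1.
- by exists (u * v)%g; rewrite ?pM // free_expM u0 v0 addr0.
- by exists (u^-1)%g; rewrite ?pV // free_expV u0 oppr0.
Qed.

Lemma ab_comb_bij : bijective (ab_comb (fun i => p (free_gen i))).
Proof.
set f := ab_comb _.
have f_surj q : exists a, f a == q.
  have [u Eu] := p_surj (repr q); exists (free_exp u); apply/eqP.
  by rewrite /f ab_comb_exp Eu ab_classP.
have f_inj : injective f.
  move=> a b; have [u <-] := free_exp_surj a; have [v <-] := free_exp_surj b.
  rewrite /f !ab_comb_exp => /ab_class_eqP/commutator_exp[w Ew w0].
  have /p_ker : p (w^-1 * (u^-1 * v))%g = 1%g by rewrite !(pM, pV) Ew mulVg.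
  rewrite !free_expM !free_expV w0 oppr0 add0r => /eqP.
  by rewrite addrC subr_eq0 => /eqP.
exists (fun q => xchoose (f_surj q)) => [a|q].
  by apply: f_inj; apply/eqP/(xchooseP (f_surj (f a))).
exact/eqP/(xchooseP (f_surj q)).
Qed.

End ExponentSum.

Lemma free_ab_comb_bij n : bijective (ab_comb (@free_gen n)).
Proof.
by apply: (@ab_comb_bij n _ id) => // [u|u ->]; [exists u|apply: free_exp1].
Qed.

Lemma surface_ab_comb_bij g : bijective (ab_comb (@surface_gen g)).
Proof.
apply: (@ab_comb_bij _ (surface_group g) (@coset _ _)).
- exact: cosetM.
- by move=> y; exists (repr y); apply: cosetP.
move=> u; rewrite -[u in free_exp u]invgK free_expV => /esym.
rewrite -coset1 => /coset_eqP; rewrite invg1 mul1g => Nu.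
rewrite -free_expV invgK; move: u Nu; apply: gen_sub.
- move=> _ [r [z [-> ->]]]; rewrite conjgE !free_expM free_expV addrC addrK.
  apply: (big_ind (fun r => free_exp r = 0)) => [|u v u0 v0|i _].
  + exact: free_exp1.
  + by rewrite free_expM u0 v0 addr0.
  + exact: free_expR.
- exact: free_exp1.
- by move=> u v u0 v0; rewrite free_expM u0 v0 addr0.
- by move=> u u0; rewrite free_expV u0 oppr0.
Qed.

Definition short_exact (R : pzRingType) (A B C : lmodType R)
    (f : {linear A -> B}) (h : {linear B -> C}) :=
  [/\ injective f, forall b, h b = 0 <-> exists a, f a = b
    & forall c, exists b, h b = c].

(* Main.v *)
(* The map on the left is r |-> r *: [w], with w the surface relator, and the
   map on the right is induced by the projection F -> pi.  Exactness in the
   middle holds because [F,F] -> [pi,pi] is onto and the conjugates of w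
   represent the translates of [w].  For injectivity, the Fox derivative with
   respect to the first generator x, with values in Z[Z^2g], is additive on
   [F,F], hence linear on its abelianization; it sends [w] to
   x^-1 (y^-1 - 1), which is not a zero divisor since no nonempty finite
   subset of Z^2g is invariant under translation by y. *)
Require Import Defs.
From HB Require Import structures.
From mathcomp Require Import all_boot all_order all_algebra.
From mathcomp Require Import finmap boolp monalg.

Set Implicit Arguments.
Unset Strict Implicit.
Unset Printing Implicit Defensive.

Import GRing.Theory Num.Theory.
Local Open Scope ring_scope.

(** * Translations by group elements in a group ring *)

Section GroupRingTheory.
Variable A : zmodType.
Implicit Types (a b : A) (r : group_ring A).

Lemma gr_eltD a b : gr_elt (a + b) = gr_elt a * gr_elt b.
Proof. exact: esym (gr_mul_elt a b). Qed.

Lemma gr_elt0 : gr_elt (0 : A) = 1.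
Proof. by []. Qed.

Lemma gr_eltV a : gr_elt a * gr_elt (- a) = 1.
Proof. by rewrite -gr_eltD addrN. Qed.

Lemma mcoeff_gr_eltM a b r : mcoeff (a + b) (gr_elt a * r) = mcoeff b r.
Proof.
move: r; apply: gr_additive_eq => [r s|r s|c]; rewrite ?mulrDr ?mcoeffD //.
by rewrite -gr_eltD !mcoeffU (inj_eq (addrI a)).
Qed.

(** Translation by [a] permutes the finite support of [r], which is impossible for a nonempty
    support when [a] has infinite order. *)
Lemma gr_elt_fixed a r :
  (forall n, a *+ n = 0 -> n = 0%N) -> gr_elt a * r = r -> r = 0.
Proof.
move=> a_free ar; suff: #|` msupp r| = 0%N.
  by move/cardfs0_eq=> s0; rewrite (monalgE r) s0 big_seq_fset0.
(* Summing the elements of the support before and after translation gives |supp r| * a = 0. *)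
apply/a_free/(addIr (\sum_(b <- msupp r) b)); rewrite add0r.
have permD : perm_eq [seq a + b | b <- msupp r] (msupp r).
  apply: uniq_perm => [||b]; rewrite ?map_inj_uniq ?fset_uniq //.
    exact: addrI.
  rewrite -{1}[b](addNKr a) mem_map; last exact: addrI.
  by rewrite -!mcoeff_neq0 -(mcoeff_gr_eltM a) ar addNKr.
rewrite -[in RHS](perm_big _ permD) big_map big_split /=; congr (_ + _).
by rewrite big_const_seq count_predT iter_addr_0.
Qed.

End GroupRingTheory.

Lemma rV_int_free n (a : 'rV[int]_n) m : a != 0 -> a *+ m = 0 -> m = 0%N.
Proof.
case/rV0Pn=> i ai /(congr1 (fun b : 'rV[int]_n => b 0 i)) /eqP.
by rewrite mulmxnE mxE mulrn_eq0 (negbTE ai) orbF => /eqP.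
Qed.

(** The left side is the product rule applied to x^-1 y^-1 x y: [a], [b], [e] stand for the classes
    of x^-1, y^-1, x, and [u], [v] for the Fox derivatives of x and y. *)
Lemma commutator_fox_identity (R : pzRingType) (a b e u v : R) :
    a * b * e = b ->
  - (a * u) + a * (- (b * v) + b * (u + e * v)) =
    (a * b - a) * u + (b - a * b) * v.
Proof.
move=> abK; rewrite !mulrDr !mulrN !mulrBl !mulrA abK addrC [RHS]addrAC.
by congr (_ - _); rewrite [LHS]addrC -addrA.
Qed.

(** * Fox derivatives on the free group, with coefficients in Z[Z^n] *)

Section FoxDerivative.
Variables (n : nat) (j : 'I_n).
Local Notation R := (group_ring 'rV[int]_n).

(** The value on an inverse letter is forced by the product rule d(uv) = du + [u] dv and d(1) =
    0. *)
Definition fox_letter (l : letter n) : R :=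
  if l.1 == j then if l.2 then - gr_elt (- delta_mx 0 j) else 1 else 0.

Fixpoint word_fox (w : word n) : R :=
  if w is l :: w' then fox_letter l + gr_elt (letter_exp l) * word_fox w'
  else 0.

Lemma word_fox_cat v w :
  word_fox (v ++ w) = word_fox v + gr_elt (word_exp v) * word_fox w.
Proof.
elim: v => [|l v IHv] /=.
  by rewrite /word_exp big_nil gr_elt0 mul1r add0r.
by rewrite IHv mulrDr addrA /word_exp big_cons gr_eltD mulrA.
Qed.

Lemma fox_letter_cancel l :
  fox_letter l + gr_elt (letter_exp l) * fox_letter (inv_letter l) = 0.
Proof.
case: l => i b; rewrite /fox_letter /letter_exp /=.
case: eqP => [->|_]; last by rewrite mulr0 addr0.
case: b; rewrite /= ?expr0 ?expr1 ?mulr1z ?mulrN1z.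
  by rewrite mulr1 addNr.
by rewrite mulrN gr_eltV addrN.
Qed.

Lemma word_fox_equiv v w : word_equiv v w -> word_fox v = word_fox w.
Proof.
elim=> // [u {}v {}w _ -> _ -> //|u l {}v].
rewrite !word_fox_cat /=; congr (_ + _ * _).
have exp0 : letter_exp l + letter_exp (inv_letter l) = 0.
  by rewrite /letter_exp -mulrzDr; case: l => i [].
rewrite mulrDr addrA fox_letter_cancel add0r mulrA -gr_eltD exp0.
by rewrite gr_elt0 mul1r.
Qed.

Definition free_fox (u : free_group n) : R := word_fox (repr u).

Lemma free_foxM u v :
  free_fox (u * v)%g = free_fox u + gr_elt (free_exp u) * free_fox v.
Proof.
rewrite -word_fox_cat; apply: word_fox_equiv; apply/word_class_eqP.
by rewrite word_class_cat !word_classP.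
Qed.

Lemma free_fox1 : free_fox 1%g = 0.
Proof.
apply: (addIr (free_fox 1%g)); rewrite add0r -[in RHS](mulg1 1%g) free_foxM.
by rewrite free_exp1 gr_elt0 mul1r.
Qed.

Lemma free_foxV u : free_fox u^-1%g = - (gr_elt (- free_exp u) * free_fox u).
Proof.
apply/eqP; rewrite -addr_eq0 -free_expV -free_foxM mulVg; exact/eqP/free_fox1.
Qed.

Lemma free_fox_gen i : free_fox (free_gen i) = (i == j)%:R.
Proof.
have /word_class_eqP/word_fox_equiv := word_classP (free_gen i).
rewrite /free_fox => ->; rewrite /= mulr0 addr0 /fox_letter /=.
by case: (i == j).
Qed.

Lemma free_foxR u v :
  free_fox [~ u, v]%g =
    (gr_elt (- free_exp u - free_exp v) - gr_elt (- free_exp u)) * free_fox u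
    + (gr_elt (- free_exp v) - gr_elt (- free_exp u - free_exp v)) * free_fox v.
Proof.
rewrite /commg /conjg free_foxM free_foxV free_expV free_foxM free_foxV.
rewrite free_expV free_foxM gr_eltD.
set a := gr_elt (- free_exp u); set b := gr_elt (- free_exp v).
have abK : a * b * gr_elt (free_exp u) = b by rewrite mulrC mulrA gr_eltV mul1r.
exact: commutator_fox_identity.
Qed.

(** Factors with zero exponent sum act trivially in the product rule; the induction therefore
    carries the exponent sum of the partial product. *)
Lemma free_fox_prod I (s : seq I) (P : pred I) (F : I -> free_group n) :
    (forall i, free_exp (F i) = 0) ->
  free_fox (\prod_(i <- s | P i) F i)%g = \sum_(i <- s | P i) free_fox (F i).
Proof.
move=> F0.
suff [//] : free_fox (\prod_(i <- s | P i) F i)%g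
              = \sum_(i <- s | P i) free_fox (F i)
            /\ free_exp (\prod_(i <- s | P i) F i)%g = 0.
apply: (big_ind2 (fun u r => free_fox u = r /\ free_exp u = 0)) => //.
- by rewrite free_fox1 free_exp1.
move=> u _ v _ [<- u0] [<- v0].
by rewrite free_foxM free_expM u0 v0 gr_elt0 mul1r addr0.
Qed.

End FoxDerivative.

(** * The Fox derivative as a linear form on [F,F]^ab *)

Section FoxAbelianization.
Variables (n : nat) (j : 'I_n).
Local Notation F := (free_group n).

Lemma free_exp_comm (u : F) : commutator_subgroup F u -> free_exp u = 0.
Proof.
by case/(commutator_exp (p := id)) => // [v|v <-]; [exists v|].
Qed.

Definition comm_fox (c : commutator_group F) := free_fox j (comm_val c).

Lemma free_exp_val (c : commutator_group F) : free_exp (comm_val c) = 0.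
Proof. exact/free_exp_comm/asboolP/comm_valP. Qed.

Lemma comm_foxM c d : comm_fox (c * d)%g = comm_fox c + comm_fox d.
Proof. by rewrite /comm_fox free_foxM free_exp_val gr_elt0 mul1r. Qed.

Lemma comm_foxV c : comm_fox c^-1%g = - comm_fox c.
Proof. by rewrite /comm_fox free_foxV free_exp_val oppr0 gr_elt0 mul1r. Qed.

Lemma comm_fox_comm c :
  commutator_subgroup (commutator_group F) c -> comm_fox c = 0.
Proof.
move: c; apply: gen_sub => [_ [c [d ->]]||c d c0 d0|c c0].
- by rewrite /commg /conjg !(comm_foxM, comm_foxV) addrCA addKr addNr.
- exact: free_fox1.
- by rewrite comm_foxM c0 d0 addr0.
- by rewrite comm_foxV c0 oppr0.
Qed.

Definition fox (v : commutator_module (@free_gen n)) := comm_fox (repr v).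

Lemma fox_ab c : fox (ab_class c) = comm_fox c.
Proof.
have /ab_class_eqP/comm_fox_comm := ab_classP (ab_class c).
by rewrite comm_foxM comm_foxV addrC => /eqP; rewrite subr_eq0 => /eqP.
Qed.

Lemma foxD u v : fox (u + v) = fox u + fox v.
Proof.
by rewrite -(ab_classP u) -(ab_classP v) -ab_classM !fox_ab comm_foxM.
Qed.

(** In d(u c u^-1) = du + [u] dc - [u c u^-1] du the outer terms cancel, since [c] has zero exponent
    sum. *)
Lemma fox_conj (u : F) c :
  comm_fox (conj_comm u c) = gr_elt (free_exp u) * comm_fox c.
Proof.
rewrite /comm_fox /= !free_foxM free_foxV free_expM free_exp_val addr0.
by rewrite mulrN mulrA gr_eltV mul1r addrC addKr.
Qed.

Lemma foxZ r v : fox (r *: v) = r * fox v.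
Proof.
move: r; apply: gr_additive_eq => [r s|r s|a].
- by rewrite scalerDl foxD.
- exact: mulrDl.
have [u <-] := free_exp_surj a.
rewrite [_ *: _]cm_scale_elt (ab_comb_exp (p := id)) // ab_actE.
by rewrite -[v in LHS]ab_classP conj_abE fox_ab fox_conj.
Qed.

End FoxAbelianization.

(** * Maps induced on commutator subgroups and their abelianizations *)

Section InducedMap.
Variables (G H : groupType) (p : UMagmaMorphism.type G H).
Local Open Scope group_scope.

Lemma commutator_morph x :
  commutator_subgroup G x -> commutator_subgroup H (p x).
Proof.
move: x; apply: gen_sub => [_ [x [y ->]]||x y Hx Hy|x Hx].
- by apply: gen_mem; exists (p x), (p y); rewrite gmulfR.
- by rewrite gmulf1; apply: nsg1.
- by rewrite gmulfM; apply: nsgM.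
- by rewrite gmulfV; apply: nsgV.
Qed.

Fact comm_map_subproof (c : commutator_group G) :
  in_commutator_subgroup (p (comm_val c)).
Proof. exact/asboolP/commutator_morph/asboolP/comm_valP. Qed.

Definition comm_map c := CommutatorGroup (comm_map_subproof c).

Fact comm_mapF : {morph comm_map : x y / x / y}.
Proof. by move=> c d; apply: val_inj => /=; apply: gmulfF. Qed.

HB.instance Definition _ := isGroupMorphism.Build
  (commutator_group G) (commutator_group H) comm_map comm_mapF.

Definition comm_ab_map (v : abelianization (commutator_group G)) :
  abelianization (commutator_group H) := ab_class (comm_map (repr v)).

Hypothesis p_surj : forall y, exists x, p x = y.

Lemma commutator_lift y : commutator_subgroup H y ->
  exists2 x, commutator_subgroup G x & p x = y.
Proof.
move: y; apply: gen_sub => [_ [b [c ->]]||_ _ [x Gx <-] [y Gy <-]|_ [x Gx <-]].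
- have [[x <-] [y <-]] := (p_surj b, p_surj c).
  by exists [~ x, y]; rewrite ?gmulfR //; apply: gen_mem; exists x, y.
- by exists 1; rewrite ?gmulf1 //; apply: nsg1.
- by exists (x * y); rewrite ?gmulfM //; apply: nsgM.
- by exists x^-1; rewrite ?gmulfV //; apply: nsgV.
Qed.

End InducedMap.

Section InducedAbelianization.
Variables (G H : groupType) (p : UMagmaMorphism.type G H).

Lemma comm_ab_mapE c : comm_ab_map p (ab_class c) = ab_class (comm_map p c).
Proof.
apply/ab_class_eqP; rewrite -gmulfV -gmulfM; apply: commutator_morph.
exact/ab_class_eqP/ab_classP.
Qed.

Lemma comm_ab_mapD u v :
  comm_ab_map p (u + v) = comm_ab_map p u + comm_ab_map p v.
Proof.
rewrite -(ab_classP u) -(ab_classP v) -ab_classM !comm_ab_mapE gmulfM.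
exact: ab_classM.
Qed.

Hypothesis p_surj : forall y, exists x, p x = y.

Lemma comm_map_surj d : exists c, comm_map p c = d.
Proof.
have /asboolP/(commutator_lift p_surj)[x /asboolP Gx Ex] := comm_valP d.
by exists (CommutatorGroup Gx); apply: val_inj.
Qed.

Lemma comm_ab_map_surj v : exists u, comm_ab_map p u = v.
Proof.
have [c Ec] := comm_map_surj (repr v).
by exists (ab_class c); rewrite comm_ab_mapE Ec ab_classP.
Qed.

(** The image of [c] is a product of commutators of elements of [H,H] and their inverses. Lifting it
    to such a product [d] over [G,G] and dividing [c] by [d] leaves the class of [c] unchanged. *)
Lemma comm_ab_map_ker c : comm_ab_map p (ab_class c) = 0 ->
  exists2 k, p (comm_val k) = 1%g & ab_class k = ab_class c.
Proof.
rewrite comm_ab_mapE -ab_class1 => /esym/ab_class_eqP; rewrite invg1 mul1g.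
(* The lifting lemma is applied here to the surjection [G,G] -> [H,H] instead of G -> H. *)
case/(commutator_lift comm_map_surj) => d Gd Edc; exists (d^-1 * c)%g.
  rewrite gmulfM gmulfV.
  by have /(congr1 (@comm_val H)) /= -> := Edc; rewrite mulVg.
suff d0 : ab_class d = 0 by rewrite ab_classM ab_classV d0 oppr0 add0r.
by apply/esym/ab_class_eqP; rewrite invg1 mul1g.
Qed.

End InducedAbelianization.

(** Since every vector is an exponent sum, this turns statements about monomials into statements
    about conjugation; [p := idfun] gives the module of the free group itself. *)
Lemma gr_elt_free_exp n (G : groupType)
    (p : UMagmaMorphism.type (free_group n) G) u (c : commutator_group G) :
  gr_elt (free_exp u) *:
      (ab_class c : commutator_module (fun i => p (free_gen i))) =
    ab_class (conj_comm (p u) c).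
Proof.
by rewrite [LHS]cm_scale_elt ab_comb_exp ?ab_actE ?conj_abE //; apply: gmulfM.
Qed.

(** * Linearity of the induced map and coset projections *)

Section InducedLinear.
Variables (n : nat) (G : groupType).
Variable p : UMagmaMorphism.type (free_group n) G.
Local Notation gens := (fun i => p (free_gen i)).

Definition commutator_module_map (v : commutator_module (@free_gen n)) :
  commutator_module gens := comm_ab_map p v.

Fact commutator_module_map_linear : linear commutator_module_map.
Proof.
move=> r u v; rewrite [LHS]comm_ab_mapD; congr (_ + _).
move: r; apply: gr_additive_eq => [r s|r s|a].
- by rewrite scalerDl [LHS]comm_ab_mapD.
- exact: scalerDl.
have [w <-] := free_exp_surj a; rewrite -(ab_classP u).
rewrite (gr_elt_free_exp idfun) [in RHS]/commutator_module_map.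
rewrite !comm_ab_mapE gr_elt_free_exp; congr ab_class; apply: val_inj => /=.
by rewrite !gmulfM gmulfV.
Qed.

HB.instance Definition _ := GRing.isLinear.Build _ _ _ _
  commutator_module_map commutator_module_map_linear.

End InducedLinear.

Section Coset.
Variables (G : groupType) (N : normal_subgroup G).

Fact cosetF : {morph @coset G N : x y / (x / y)%g}.
Proof. by move=> x y; rewrite cosetM cosetV. Qed.

HB.instance Definition _ :=
  isGroupMorphism.Build G (quotient_group N) (@coset G N) cosetF.

Lemma coset_surj u : exists x, coset N x = u.
Proof. by exists (repr u); apply: cosetP. Qed.

Lemma coset_eq1 x : coset N x = 1%g <-> N x.
Proof.
by split=> [/esym/coset_eqP|Nx]; [|apply/esym/coset_eqP]; rewrite invg1 mul1g.
Qed.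

End Coset.

(** * The submodule generated by a single relator in [F,F] *)

Section OneRelator.
Variables (n : nat) (w : commutator_group (free_group n)).
Local Notation F := (free_group n).
Local Notation R := (group_ring 'rV[int]_n).

Definition relator_multiple (r : R^o) : commutator_module (@free_gen n) :=
  r *: (ab_class w : commutator_module (@free_gen n)).

Fact relator_multiple_linear : linear relator_multiple.
Proof. by move=> a r s; rewrite /relator_multiple scalerDl scalerA. Qed.

HB.instance Definition _ := GRing.isLinear.Build _ _ _ _
  relator_multiple relator_multiple_linear.

Local Notation N := (normal_closure (fun r => r = comm_val w)).

Lemma normal_closure_multiple (c : commutator_group F) :
  N (comm_val c) -> exists r, relator_multiple r = ab_class c.
Proof.
(* The induction runs over elements of F, so it must also produce their lifts to [F,F]. *)
suff T u : N u -> exists2 d : commutator_group F, comm_val d = u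
    & exists r, relator_multiple r = ab_class d.
  by case/T=> d /val_inj <-.
move: u; apply: gen_sub => [_ [_ [z [-> ->]]]||_ _ [d <- [r Er]] [e <- [s Es]]
                           |_ [d <- [r Er]]].
(* The inverse appears because [w ^ z] is z^-1 w z, while [conj_comm] conjugates on the other
   side. *)
- exists (conj_comm z^-1%g w); first by rewrite /= invgK conjgE mulgA.
  by exists (gr_elt (free_exp z^-1%g)); apply: (gr_elt_free_exp idfun).
- by exists 1%g => //; exists 0; apply: linear0.
- by exists (d * e)%g => //; exists (r + s); rewrite linearD /= Er Es ab_classM.
- by exists d^-1%g => //; exists (- r); rewrite linearN /= Er ab_classV.
Qed.

End OneRelator.

(** * The surface relator and the exact sequence *)

Section Surface.
Variable g : nat.
Local Notation F := (free_group (2 * g)).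

Lemma surface_relator_comm : commutator_subgroup F (surface_relator g).
Proof.
apply: (big_ind (commutator_subgroup F)) => [|u v|i _]; first exact: nsg1.
  exact: nsgM.
by apply: gen_mem; do 2!eexists.
Qed.

Definition comm_relator : commutator_group F :=
  CommutatorGroup (introT (asboolP _) surface_relator_comm).

Definition surface_projection : F -> surface_group g := @coset _ _.

HB.instance Definition _ := UMagmaMorphism.on surface_projection.

(** Only the [k]-th handle contains the chosen generator, and only the first term of [free_foxR]
    survives there. *)
Lemma free_fox_relator (k : 'I_g) :
  free_fox (surface_index0 k) (surface_relator g) =
    gr_elt (- delta_mx 0 (surface_index0 k)) *
    (gr_elt (- delta_mx 0 (surface_index1 k)) - 1).
Proof.
rewrite free_fox_prod => [|i]; last exact: free_expR.
(* The two indices have opposite parity. *)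
have neq01 i : (surface_index1 i == surface_index0 k) = false.
  apply/eqP=> /(congr1 (odd \o val)).
  by rewrite /= !mul2n /= !odd_double.
rewrite (bigD1 k) //= big1 => [|i ik].
  rewrite addr0 free_foxR !free_exp_gen !free_fox_gen eqxx neq01 gr_eltD.
  have E (R : pzRingType) (a b c : R) :
      (a * b - a) * true%:R + c * false%:R = a * (b - 1).
    by rewrite mulr1 mulr0 addr0 mulrBr mulr1.
  exact: E.
rewrite free_foxR !free_fox_gen neq01 -val_eqE /= eqn_pmul2l //.
rewrite val_eqE (negbTE ik).
have E (R : pzRingType) (a b : R) : a * false%:R + b * false%:R = 0.
  by rewrite !mulr0 addr0.
exact: E.
Qed.

Lemma relator_multiple_inj :
  (0 < g)%N -> injective (relator_multiple comm_relator).
Proof.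
move=> g_gt0; apply: raddf_inj => r r0; pose k := Ordinal g_gt0.
set x := delta_mx 0 (surface_index0 k) : 'rV[int]_(2 * g).
set y := delta_mx 0 (surface_index1 k) : 'rV[int]_(2 * g).
have fox_r : r * (gr_elt (- x) * (gr_elt (- y) - 1)) = 0.
  rewrite -free_fox_relator.
  have := foxZ (surface_index0 k) r (ab_class comm_relator).
  by rewrite fox_ab => <-; rewrite [_ *: _]r0 -(scale0r 0) foxZ mul0r.
(* Applied to [fox_r], this says that r x^-1 is invariant under translation by -y, so it vanishes
   because y has infinite order. *)
have E (R : comPzRingType) (a b c : R) :
    a * (b * (c - 1)) = 0 -> c * (a * b) = a * b.
  by rewrite mulrA mulrBr mulr1 mulrC => /eqP; rewrite subr_eq0 => /eqP.
have rx0 : r * gr_elt (- x) = 0.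
  apply: gr_elt_fixed (E _ _ _ _ fox_r) => m.
  apply: rV_int_free; rewrite oppr_eq0.
  apply/eqP=> /matrixP/(_ 0 (surface_index1 k)).
  by rewrite !mxE !eqxx.
(* It remains to cancel the unit x^-1. *)
have {}E (R : pzRingType) (a b c : R) : a * b = 0 -> b * c = 1 -> a = 0.
  by move=> ab0 bc1; rewrite -[a]mulr1 -bc1 mulrA ab0 mul0r.
exact: E rx0 (gr_eltV _).
Qed.

End Surface.

Theorem theorem6 (g : nat) (g_ge1 : (1 <= g)%N) :
  exists (f : {linear (group_ring 'rV[int]_(2 * g))^o ->
                      commutator_module (@free_gen (2 * g))})
         (h : {linear commutator_module (@free_gen (2 * g)) ->
                      commutator_module (@surface_gen g)}),
    short_exact f h.
Proof.
exists (relator_multiple (comm_relator g)).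
(* [surface_gen i] unfolds to the projection of [free_gen i], so the two module structures on the
   target agree by conversion. *)
exists (commutator_module_map (@surface_projection g)); split.
- exact: relator_multiple_inj.
- move=> v; split=> [|[r <-]].
    (* The class [v] gets a representative that dies in the surface group, hence lies in the normal
       closure of the relator. *)
    rewrite -[v]ab_classP => /(comm_ab_map_ker (@coset_surj _ _)).
    case=> k /coset_eq1 Nk <-.
    by have [r Er] := @normal_closure_multiple _ (comm_relator g) k Nk; exists r.
  (* By linearity it suffices that the class of the relator maps to 0. *)
  rewrite /relator_multiple linearZ /=.
  suff -> : commutator_module_map (@surface_projection g)
              (ab_class (comm_relator g)) = 0 by rewrite scaler0.
  rewrite [LHS]comm_ab_mapE -ab_class1; congr ab_class; apply: val_inj.
  apply/coset_eq1/gen_mem; exists (surface_relator g), 1%g.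
  by rewrite conjg1.
- exact: (comm_ab_map_surj (@coset_surj _ _)).
Qed.
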